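(* Let $n\ge 1$ be an integer and let $\mathcal{K}^{n*}$ be the family of all convex bodies $K\subset\mathbb{E}^n$ with $B^n\subseteq K\subseteq nB^n$. For every pair of convex bodies $K_1,K_2\in\mathcal{K}^{n*}$, we have $$\|K_1,K_2\|\le 2\cdot\|K_1,K_2\|^*,$$ where $\|\cdot\|$ is the Banach-Mazur metric and $\|\cdot\|^*$ is the Hausdorff metric.
   Context: An $n$-dimensional convex body is a compact convex subset of Euclidean space $\mathbb{E}^n$ with nonempty interior; $\mathcal{K}^n$ is the family of all of them. $B^n$ is the closed unit ball of $\mathbb{E}^n$ centered at the origin, and $+$ denotes the Minkowski sum. The Hausdorff metric is $\|K_1,K_2\|^*=\min\{r:\ K_1\subseteq K_2+rB^n,\ K_2\subseteq K_1+rB^n\}$. Let $\mathcal{T}^n$ be the family of all nonsingular affine linear transformations from $\mathbb{E}^n$ to $\mathbb{E}^n$. The Banach-Mazur metric is $$\|K_1,K_2\|=\log\min\{r:\ K_1\subseteq\sigma(K_2)\subseteq rK_1+\mathbf{x};\ \mathbf{x}\in\mathbb{E}^n;\ \sigma\in\mathcal{T}^n\},$$ with $\log$ the natural logarithm. *)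

(* Defs.v *)
From mathcomp Require Import all_boot all_order all_algebra.
From mathcomp Require Import all_classical all_reals all_analysis.
Import Order.TTheory GRing.Theory Num.Theory.
Import numFieldNormedType.Exports.

Set Implicit Arguments.
Unset Strict Implicit.
Unset Printing Implicit Defensive.

Local Open Scope classical_set_scope.
Local Open Scope ring_scope.

(* Euclidean n-space is 'rV[R]_n.  The library norm on 'rV[R]_n is the sup norm; it induces the Euclidean
   topology, so `compact` and `interior` are the usual notions, but metric
   notions must go through enorm. *)

Section Definitions.
Context {R : realType} {n : nat}.
Implicit Types (K A B : set 'rV[R]_n) (x : 'rV[R]_n) (r : R).

Definition enorm x : R := Num.sqrt (\sum_(i < n) x ord0 i ^+ 2).

Definition unit_ball : set 'rV[R]_n := [set x | enorm x <= 1].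

Definition minkowski_sum A B : set 'rV[R]_n := [set a + b | a in A & b in B].

Definition dilate r A : set 'rV[R]_n := [set r *: a | a in A].

Definition translate A x : set 'rV[R]_n := [set a + x | a in A].

Definition convex_body K : Prop :=
  [/\ compact K, convex_set (M := 'rV[R]_n) K & interior K !=set0].

(* In both distances the minimum over r is rendered by the library infimum
   `inf`; for convex bodies both sets are nonempty and, by compactness, attain
   their infimum, which is then the minimum. *)

Definition hausdorff_dist K1 K2 : R :=
  inf [set r | [/\ 0 <= r,
                   K1 `<=` minkowski_sum K2 (dilate r unit_ball) &
                   K2 `<=` minkowski_sum K1 (dilate r unit_ball)]].

(* Row vectors: the linear part acts by multiplication on the right. *)
Definition nonsingular_affine (s : 'rV[R]_n -> 'rV[R]_n) : Prop :=
  exists2 M : 'M[R]_n, M \in unitmx &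
    exists b : 'rV[R]_n, forall x, s x = x *m M + b.

(* The ratio r has to be positive: allowing r < 0 would admit reflected copies
   of K1 of arbitrarily large size, and no minimum would exist. *)
Definition banach_mazur_dist K1 K2 : R :=
  ln (inf [set r | 0 < r /\
        exists s : 'rV[R]_n -> 'rV[R]_n, exists x,
          [/\ nonsingular_affine s, K1 `<=` s @` K2 &
              s @` K2 `<=` translate (dilate r K1) x]]).

Definition Kstar : set (set 'rV[R]_n) :=
  [set K | [/\ convex_body K, unit_ball `<=` K &
               K `<=` dilate n%:R unit_ball]].

End Definitions.

(* Main.v *)
(* If K1 is within Hausdorff distance r of K2, then, since K2 contains the unit
   ball and is convex, K1 is contained in K2 + r K2 = (1 + r) K2, and symmetrically.
   Hence K1 <= (1 + r) K2 <= (1 + r)^2 K1, and ln ((1 + r)^2) <= 2 r. *)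
Require Import Defs.
From mathcomp Require Import all_boot all_order all_algebra.
From mathcomp Require Import all_classical all_reals all_analysis.
From mathcomp Require Import ring lra.
Import Order.TTheory GRing.Theory Num.Theory.

Local Open Scope classical_set_scope.
Local Open Scope ring_scope.

Lemma unit_ball0 (R : realType) (n : nat) : @unit_ball R n 0.
Proof.
rewrite /unit_ball /enorm /= big1 ?sqrtr0 ?ler01// => i _.
by rewrite mxE expr0n.
Qed.

Lemma dilateM {R : realType} {n : nat} (r s : R) (A : set 'rV[R]_n) :
  dilate r (dilate s A) = dilate (r * s) A.
Proof.
apply/seteqP; split => x.
  by move=> [_ [a Aa <-] <-]; exists a; rewrite ?scalerA.
by move=> [a Aa <-]; exists (s *: a); [exists a|rewrite scalerA].
Qed.

(** For [a] in [K] and [b] in [B], the point [a + r *: b] is [1 + r] times the convex combination of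
    [a] and [b] with weights [1 / (1 + r)] and [r / (1 + r)]. *)
Lemma minkowski_sum_dilate {R : realType} {n : nat} {r : R} {K B : set 'rV[R]_n} :
  0 <= r -> convex_set (M := 'rV[R]_n) K -> B `<=` K ->
  minkowski_sum K (dilate r B) `<=` dilate (1 + r) K.
Proof.
move=> r0 cK BK _ [a Ka [_ [b /BK Kb <-] <-]].
have r1_gt0 : 0 < 1 + r by lra.
have t0 : 0 <= (1 + r)^-1 by rewrite invr_ge0 ltW.
have t1 : (1 + r)^-1 <= 1 by rewrite invf_le1// lerDl.
have := cK a b (Itv01 t0 t1) (mem_set Ka) (mem_set Kb).
rewrite inE => Kab; eexists; first exact: Kab.
rewrite /conv /= scalerDr !scalerA.
have -> : (1 + r) * (1 + r)^-1 = 1 by field; lra.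
have -> : (1 + r) * unstable.onem (1 + r)^-1 = r by rewrite /unstable.onem; field; lra.
by rewrite scale1r.
Qed.

Lemma nonsingular_affine_scale {R : realType} {n : nat} (r : R) :
  r != 0 -> nonsingular_affine (fun x : 'rV[R]_n => r *: x).
Proof.
move=> r0; exists r%:M.
  by rewrite unitmxE det_scalar unitfE expf_neq0.
by exists 0 => x; rewrite addr0 mul_mx_scalar.
Qed.

(* [1 <= r] makes up for the convention [ln x = 0] when [x <= 0]. *)
Lemma ln_inf_le {R : realType} (E : set R) (r : R) :
  has_lbound E -> E r -> 1 <= r -> ln (inf E) <= ln r.
Proof.
move=> lE Er r1; have infr : inf E <= r by exact: ge_inf.
have [inf0|inf_gt0] := leP (inf E) 0; first by rewrite ln0// ln_ge0.
by rewrite ler_ln// posrE (lt_le_trans ltr01).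
Qed.

(** The affine map is the homothety of ratio [s] about the origin, with zero translation: each
    inclusion costs one factor [s], so [s ^+ 2] is an admissible ratio. *)
Lemma banach_mazur_le_ln_sqr {R : realType} {n : nat} (K1 K2 : set 'rV[R]_n) (s : R) :
  1 <= s -> K1 `<=` dilate s K2 -> K2 `<=` dilate s K1 ->
  banach_mazur_dist K1 K2 <= ln (s ^+ 2).
Proof.
move=> s1 K12 K21; have s0 : 0 < s by rewrite (lt_le_trans ltr01).
apply: ln_inf_le; [by exists 0 => x [/ltW]| |exact: exprn_ege1].
split; first exact: exprn_gt0.
exists ( *:%R s), 0; split => //.
  by apply: nonsingular_affine_scale; rewrite gt_eqF.
move=> _ [x /K21 sK1x <-]; exists (s *: x); last by rewrite addr0.
by rewrite expr2 -dilateM; exists x.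
Qed.

Theorem theorem1 (R : realType) (n : nat) (hn : (1 <= n)%N)
    (K1 K2 : set 'rV[R]_n) (hK1 : Kstar K1) (hK2 : Kstar K2) :
  banach_mazur_dist K1 K2 <= 2 * hausdorff_dist K1 K2.
Proof.
have [[_ cK1 _] BK1 K1n] := hK1; have [[_ cK2 _] BK2 K2n] := hK2.
rewrite mulrC -ler_pdivrMr//; apply: lb_le_inf.
  (* The radius [n] is admissible: each body lies in the ball of radius [n], and the other body
     contains the origin. *)
  have sub (A B : set 'rV[R]_n) : A `<=` dilate n%:R unit_ball ->
      unit_ball `<=` B -> A `<=` minkowski_sum B (dilate n%:R unit_ball).
    by move=> An BB x /An Bx; exists 0; [exact/BB/unit_ball0|exists x; rewrite ?add0r].
  by exists n%:R; split; [exact: ler0n|exact: sub|exact: sub].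
move=> r [r0 K12 K21]; rewrite ler_pdivrMr//.
apply: (@le_trans _ _ (ln ((1 + r) ^+ 2))).
  apply: banach_mazur_le_ln_sqr; first by rewrite lerDl.
    exact: subset_trans K12 (minkowski_sum_dilate r0 cK2 BK2).
  exact: subset_trans K21 (minkowski_sum_dilate r0 cK1 BK1).
(* The exponent 2 comes out of the logarithm as the constant 2 of the bound. *)
have : ln (1 + r) <= r by apply: le_ln1Dx; lra.
by rewrite lnXn ?ltr_wpDr// mulr2n; lra.
Qed.
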